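(* Let $I$ be a finite set, let $x\in\mathbb{R}^{n_x}$ be fixed, and for each $i\in I$ let $F_i$ be a positive semidefinite real matrix. Consider the following optimisation problem in the variables $y$, $(z_i)_{i\in I}$, $(p_i)_{i\in I}$ (denoted $(Q_x)$): $$\begin{aligned}\min_{y,z_i,p_i}\quad & d_2^\top y+\sum_{i\in I}e_{i2}^\top z_i\\ \text{s.t.}\quad & A_2x+B_2y+\sum_{i\in I}C_{i2}z_i\le a_2,\\ & C_{i3}z_i\ge a_{i3}(x)\quad\forall i\in I,\\ & C_{i3}^\top p_i-F_iz_i\le e_{i3}(x)\quad\forall i\in I,\\ & \sum_{i\in I}\bigl(z_i^\top F_iz_i+e_{i3}(x)^\top z_i-a_{i3}(x)^\top p_i\bigr)\le 0,\\ & y\ge 0,\quad z_i\ge 0,\ p_i\ge 0\quad\forall i\in I.\end{aligned}$$ Then the Karush-Kuhn-Tucker conditions of $(Q_x)$ are sufficient for optimality. That is, if $y$, $(z_i)_{i\in I}$, $(p_i)_{i\in I}$ are such that there exist vectors $\gamma$, $(z_i^b)_{i\in I}$, $(p_i^b)_{i\in I}$ and a scalar $\epsilon$ satisfying $$\begin{aligned}& 0\le y\perp d_2+B_2^\top\gamma\ge 0,\\ & 0\le\gamma\perp a_2-A_2x-B_2y-\sum_{i\in I}C_{i2}z_i\ge 0,\\ & 0\le z_i\perp e_{i2}+C_{i2}^\top\gamma-C_{i3}^\top p_i^b-F_i^\top z_i^b+\epsilon(F_i+F_i^\top)z_i+\epsilon\, e_{i3}(x)\ge 0\quad\forall i\in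 I,\\ & 0\le p_i\perp C_{i3}z_i^b-\epsilon\, a_{i3}(x)\ge 0\quad\forall i\in I,\\ & 0\le z_i^b\perp e_{i3}(x)-C_{i3}^\top p_i+F_iz_i\ge 0\quad\forall i\in I,\\ & 0\le p_i^b\perp C_{i3}z_i-a_{i3}(x)\ge 0\quad\forall i\in I,\\ & 0\le\epsilon\perp-\sum_{i\in I}\bigl(z_i^\top F_iz_i+e_{i3}(x)^\top z_i-a_{i3}(x)^\top p_i\bigr)\ge 0,\end{aligned}$$ then $(y,(z_i)_{i\in I},(p_i)_{i\in I})$ is an optimal solution of $(Q_x)$.
   Context: All vectors and matrices are real and of compatible dimensions; inequalities between vectors are componentwise. For vectors $a,b$ of equal dimension, $0\le a\perp b\ge 0$ means $a\ge 0$, $b\ge 0$ and $a^\top b=0$. The vectors $d_2,e_{i2},a_2$ and the matrices $A_2,B_2,C_{i2},C_{i3},F_i$ are given data, and $x\mapsto a_{i3}(x)$, $x\mapsto e_{i3}(x)$ are given vector-valued functions of the top-level variable $x$ only; they do not depend on $y$ (this is called a weak trilevel structure). The problem $(Q_x)$ arises in a trilevel model: $x$ is the top-level decision, $y$ the middle-level decision, and the bottom level consists of the convex quadratic problems, one for each $i\in I$, $$\min_{z_i\ge 0}\ \tfrac12 z_i^\top F_iz_i+e_{i3}(x)^\top z_i\quad\text{s.t.}\quad C_{i3}z_i\ge a_{i3}(x),$$ with duals $$\max_{p_i\ge 0,\,z_i}\ -\tfrac12 z_i^\top F_iz_i+a_{i3}(x)^\top p_i\quad\text{s.t.}\quad C_{i3}^\top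 p_i-F_iz_i\le e_{i3}(x).$$ In $(Q_x)$, bottom-level optimality is expressed by primal feasibility, dual feasibility, and the aggregated strong-duality inequality. In the KKT system, $\gamma$, $p_i^b$, $z_i^b$ and $\epsilon$ are the multipliers of, respectively, the first, second, third and fourth constraints of $(Q_x)$. *)

(* Defs.v *)
From HB Require Import structures.
From mathcomp Require Import all_boot all_order all_algebra.
From mathcomp Require Import reals.

Set Implicit Arguments.
Unset Strict Implicit.
Unset Printing Implicit Defensive.

Import Order.TTheory GRing.Theory Num.Theory.
Local Open Scope ring_scope.

Definition vle (R : realType) (n : nat) (u v : 'cV[R]_n) : Prop :=
  forall k, u k 0 <= v k 0.

Notation "u <=v v" := (vle u v) (at level 70, no associativity) : ring_scope.

Definition dot (R : realType) (n : nat) (u v : 'cV[R]_n) : R :=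
  (u^T *m v) 0 0.

Definition compl (R : realType) (n : nat) (u v : 'cV[R]_n) : Prop :=
  [/\ 0 <=v u, 0 <=v v & dot u v = 0].

Definition scompl (R : realType) (s t : R) : Prop :=
  [/\ 0 <= s, 0 <= t & s * t = 0].

(* Symmetry is not part of the definition: the KKT system below keeps F and
   F^T apart. *)
Definition psdmx (R : realType) (n : nat) (F : 'M[R]_n) : Prop :=
  forall v : 'cV[R]_n, 0 <= dot v (F *m v).

(* The block sizes [nz i] and [np i] may depend on the bottom-level index [i].
   [a3] and [e3] take the top-level variable only (weak trilevel structure). *)
Record trilevel (R : realType) (I : finType) : Type := Trilevel {
  nx : nat;
  ny : nat;
  mg : nat;
  nz : I -> nat;
  np : I -> nat;
  d2 : 'cV[R]_ny;
  a2 : 'cV[R]_mg;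
  A2 : 'M[R]_(mg, nx);
  B2 : 'M[R]_(mg, ny);
  e2 : forall i, 'cV[R]_(nz i);
  C2 : forall i, 'M[R]_(mg, nz i);
  C3 : forall i, 'M[R]_(np i, nz i);
  F  : forall i, 'M[R]_(nz i);
  a3 : forall i, 'cV[R]_nx -> 'cV[R]_(np i);
  e3 : forall i, 'cV[R]_nx -> 'cV[R]_(nz i)
}.

Arguments nx {R I}.
Arguments ny {R I}.
Arguments mg {R I}.
Arguments nz {R I}.
Arguments np {R I}.
Arguments d2 {R I}.
Arguments a2 {R I}.
Arguments A2 {R I}.
Arguments B2 {R I}.
Arguments e2 {R I}.
Arguments C2 {R I}.
Arguments C3 {R I}.
Arguments F {R I}.
Arguments a3 {R I}.
Arguments e3 {R I}.

Definition Q_objective (R : realType) (I : finType) (D : trilevel R I)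
    (y : 'cV[R]_(ny D)) (z : forall i, 'cV[R]_(nz D i)) : R :=
  dot (d2 D) y + \sum_(i : I) dot (e2 D i) (z i).

(* Left-hand side of the aggregated strong-duality inequality. *)
Definition duality_gap (R : realType) (I : finType) (D : trilevel R I)
    (x : 'cV[R]_(nx D))
    (z : forall i, 'cV[R]_(nz D i)) (p : forall i, 'cV[R]_(np D i)) : R :=
  \sum_(i : I) (dot (z i) (F D i *m z i) + dot (e3 D i x) (z i)
                - dot (a3 D i x) (p i)).

Record Q_feasible (R : realType) (I : finType) (D : trilevel R I)
    (x : 'cV[R]_(nx D)) (y : 'cV[R]_(ny D))
    (z : forall i, 'cV[R]_(nz D i)) (p : forall i, 'cV[R]_(np D i)) : Prop :=
  QFeasible {
  Q_coupling :
    A2 D *m x + B2 D *m y + \sum_(i : I) C2 D i *m z i <=v a2 D;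
  Q_primal : forall i, a3 D i x <=v C3 D i *m z i;
  Q_dual : forall i, (C3 D i)^T *m p i - F D i *m z i <=v e3 D i x;
  Q_strong_duality : duality_gap x z p <= 0;
  Q_y_ge0 : 0 <=v y;
  Q_z_ge0 : forall i, 0 <=v z i;
  Q_p_ge0 : forall i, 0 <=v p i
}.

Definition Q_optimal (R : realType) (I : finType) (D : trilevel R I)
    (x : 'cV[R]_(nx D)) (y : 'cV[R]_(ny D))
    (z : forall i, 'cV[R]_(nz D i)) (p : forall i, 'cV[R]_(np D i)) : Prop :=
  Q_feasible x y z p /\
  forall (y' : 'cV[R]_(ny D)) (z' : forall i, 'cV[R]_(nz D i))
         (p' : forall i, 'cV[R]_(np D i)),
    Q_feasible x y' z' p' -> Q_objective y z <= Q_objective y' z'.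

(* [g], [pb], [zb], [eps] are the multipliers of the coupling, primal, dual and
   strong-duality constraints respectively. *)
Record Q_KKT (R : realType) (I : finType) (D : trilevel R I)
    (x : 'cV[R]_(nx D)) (y : 'cV[R]_(ny D))
    (z : forall i, 'cV[R]_(nz D i)) (p : forall i, 'cV[R]_(np D i))
    (g : 'cV[R]_(mg D))
    (zb : forall i, 'cV[R]_(nz D i)) (pb : forall i, 'cV[R]_(np D i))
    (eps : R) : Prop := QKKT {
  KKT_y : compl y (d2 D + (B2 D)^T *m g);
  KKT_g : compl g (a2 D - A2 D *m x - B2 D *m y - \sum_(i : I) C2 D i *m z i);
  KKT_z : forall i, compl (z i)
    (e2 D i + (C2 D i)^T *m g - (C3 D i)^T *m pb i - (F D i)^T *m zb i
     + eps *: ((F D i + (F D i)^T) *m z i) + eps *: e3 D i x);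
  KKT_p : forall i, compl (p i) (C3 D i *m zb i - eps *: a3 D i x);
  KKT_zb : forall i,
    compl (zb i) (e3 D i x - (C3 D i)^T *m p i + F D i *m z i);
  KKT_pb : forall i, compl (pb i) (C3 D i *m z i - a3 D i x);
  KKT_eps : scompl eps (- duality_gap x z p)
}.

(* Main.v *)
Require Import Defs.
From HB Require Import structures.
From mathcomp Require Import all_boot all_order all_algebra.
From mathcomp Require Import reals.
From mathcomp Require Import lra.

Set Implicit Arguments.
Unset Strict Implicit.
Unset Printing Implicit Defensive.

Import Order.TTheory GRing.Theory Num.Theory.
Local Open Scope ring_scope.

(** The objective and the first three families of constraints are affine, and
    the aggregated strong-duality constraint is a convex quadratic because each
    [F i] is positive semidefinite.  Pairing every KKT condition with a feasible
    competitor, and bounding the duality gap from below by its linearisation at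
    the KKT point, the multiplier terms cancel in the sum and leave a nonnegative
    difference of objective values. *)

Section Dot.
Variable R : realType.

Lemma dotC n (u v : 'cV[R]_n) : dot u v = dot v u.
Proof. by rewrite /dot !mxE; apply: eq_bigr => k _; rewrite !mxE mulrC. Qed.

Lemma dotDr n (u v w : 'cV[R]_n) : dot u (v + w) = dot u v + dot u w.
Proof. by rewrite /dot mulmxDr mxE. Qed.

Lemma dotNr n (u v : 'cV[R]_n) : dot u (- v) = - dot u v.
Proof. by rewrite /dot mulmxN mxE. Qed.

Lemma dotZr n a (u v : 'cV[R]_n) : dot u (a *: v) = a * dot u v.
Proof. by rewrite /dot -scalemxAr mxE. Qed.

Lemma dot_sumr (I : finType) n (u : 'cV[R]_n) (f : I -> 'cV[R]_n) :
  dot u (\sum_i f i) = \sum_i dot u (f i).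
Proof. by rewrite /dot mulmx_sumr summxE. Qed.

Lemma dotDl n (u v w : 'cV[R]_n) : dot (u + v) w = dot u w + dot v w.
Proof. by rewrite dotC dotDr !(dotC w). Qed.

Lemma dotNl n (u v : 'cV[R]_n) : dot (- u) v = - dot u v.
Proof. by rewrite dotC dotNr dotC. Qed.

(** Used left to right, it removes every transpose, so that both forms of a bilinear term become one
    atom for [lra]. *)
Lemma dot_trmx m n (u : 'cV[R]_n) (M : 'M[R]_(m, n)) (v : 'cV[R]_m) :
  dot u (M^T *m v) = dot v (M *m u).
Proof. by rewrite dotC /dot trmx_mul trmxK mulmxA. Qed.

Lemma dot_ge0 n (u v : 'cV[R]_n) : 0 <=v u -> 0 <=v v -> 0 <= dot u v.
Proof.
move=> u0 v0; rewrite /dot mxE; apply: sumr_ge0 => k _; rewrite mxE.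
by apply: mulr_ge0; [have := u0 k | have := v0 k]; rewrite mxE.
Qed.

Lemma vle_subr0 n (u v : 'cV[R]_n) : 0 <=v v - u <-> u <=v v.
Proof. by split=> h k; have := h k; rewrite !mxE subr_ge0. Qed.

End Dot.

(** Each constraint of the problem is a sign condition on one side of some complementarity pair, up
    to rearranging the slack. *)
Lemma Q_KKT_feasible (R : realType) (I : finType) (D : trilevel R I)
    (x : 'cV[R]_(nx D)) y z p g zb pb eps :
  Q_KKT x y z p g zb pb eps -> Q_feasible x y z p.
Proof.
case=> [[y0 _ _] [_ s0 _] hz hp hzb hpb [_ gap0 _]]; split=> // [|i|i||i|i].
- by apply/vle_subr0; rewrite !opprD !addrA.
- by apply/vle_subr0; case: (hpb i).
- by apply/vle_subr0; rewrite opprB addrA addrAC; case: (hzb i).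
- by rewrite -oppr_ge0.
- by case: (hz i).
- by case: (hp i).
Qed.

Section BlockInequality.
Variables (R : realType) (nz np mg : nat).
Variables (e2 e3 : 'cV[R]_nz) (a3 : 'cV[R]_np).
Variables (C2 : 'M[R]_(mg, nz)) (C3 : 'M[R]_(np, nz)) (F : 'M[R]_nz).

Let gap z p := dot z (F *m z) + dot e3 z - dot a3 p.

(** The [zb] and [pb] terms of the Lagrangian vanish at the KKT point and have a favourable sign at
    the competitor, so they drop out. The [g] and [eps] terms stay: their constraints link the
    blocks, and complementarity for them holds only after summation over the indices. *)
Lemma block_lagrangian_le (g : 'cV[R]_mg) (z zb z' : 'cV[R]_nz)
    (p pb p' : 'cV[R]_np) eps :
  psdmx F -> 0 <= eps ->
  compl z (e2 + C2^T *m g - C3^T *m pb - F^T *m zb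
           + eps *: ((F + F^T) *m z) + eps *: e3) ->
  compl p (C3 *m zb - eps *: a3) ->
  compl zb (e3 - C3^T *m p + F *m z) ->
  compl pb (C3 *m z - a3) ->
  0 <=v z' -> 0 <=v p' -> a3 <=v C3 *m z' -> C3^T *m p' - F *m z' <=v e3 ->
  dot e2 z + dot g (C2 *m z) + eps * gap z p
    <= dot e2 z' + dot g (C2 *m z') + eps * gap z' p'.
Proof.
move=> psdF eps0 [_ wz ez] [_ wp ep] [zb0 _ ezb] [pb0 _ epb] z'0 p'0.
move=> /vle_subr0 prim /vle_subr0 dual; rewrite /gap.
have := dot_ge0 z'0 wz; have := dot_ge0 p'0 wp.
have := dot_ge0 zb0 dual; have := dot_ge0 pb0 prim.
(* With [F] possibly nonsymmetric, this expands to the tangent bound z'Fz' >= z'Fz + zFz' - zFz,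
   scaled by [eps]; its cross terms match those of [(F + F^T) *m z] in the stationarity
   condition. *)
have := mulr_ge0 eps0 (psdF (z' - z)).
move: ez ep ezb epb.
rewrite !(mulmxDl, mulmxDr, mulmxN) ?opprB.
rewrite !(dotDr, dotDl, dotNr, dotNl, dotZr, dot_trmx).
rewrite (dotC z e2) (dotC z' e2) (dotC z e3) (dotC z' e3).
rewrite (dotC p a3) (dotC p' a3).
lra.
Qed.

End BlockInequality.

Theorem mainTheorem1 (R : realType) (I : finType) (D : trilevel R I)
    (x : 'cV[R]_(nx D)) (hF : forall i : I, psdmx (F D i))
    (y : 'cV[R]_(ny D)) (z : forall i : I, 'cV[R]_(nz D i))
    (p : forall i : I, 'cV[R]_(np D i))
    (hKKT : exists (g : 'cV[R]_(mg D)) (zb : forall i : I, 'cV[R]_(nz D i))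
                   (pb : forall i : I, 'cV[R]_(np D i)) (eps : R),
              Q_KKT x y z p g zb pb eps) :
  Q_optimal x y z p.
Proof.
have [g [zb [pb [eps kkt]]]] := hKKT.
split; first exact: Q_KKT_feasible kkt.
move=> y' z' p' [/vle_subr0 s'0 prim dual gap'0 y'0 z'0 p'0].
case: kkt => [[_ wy ey] [g0 _ eg] hz hp hzb hpb [eps0 _ egap]].
have blocks : \sum_i (dot (e2 D i) (z i) + dot g (C2 D i *m z i))
      + eps * duality_gap x z p
    <= \sum_i (dot (e2 D i) (z' i) + dot g (C2 D i *m z' i))
      + eps * duality_gap x z' p'.
  rewrite /duality_gap !mulr_sumr -!big_split /=; apply: ler_sum => i _.
  exact: (block_lagrangian_le (hF i) eps0 (hz i) (hp i) (hzb i) (hpb i)).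
(* The weighted gap is nonpositive at the competitor, while [egap] makes it zero at the KKT
   point. *)
have := mulr_ge0 eps0 (etrans (oppr_ge0 _) gap'0).
have := dot_ge0 y'0 wy; have := dot_ge0 g0 s'0.
(* After expansion, the [B2] and [C2] terms paired with [g] cancel between [blocks], the [y]
   conditions and the coupling slacks. *)
move: blocks ey eg egap; rewrite /Q_objective !big_split /=.
rewrite !(opprD, dotDr, dotNr, dot_trmx, dot_sumr) (dotC y) (dotC y').
lra.
Qed.
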